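(* Let $T_1,\dots,T_k\colon[0,1]\to[0,1]$ ($k\ge2$) be continuous maps. If $\mathbb P^+$ is a mixing Markov measure on $\Sigma_k^+$ that splits $\mathrm{IFS}(T_1,\dots,T_k)$ in some non-trivial closed interval $J\subset[0,1]$, then $\mathbb P^+(S_{\mathrm t})=1$.
   Context: Let $I=[0,1]$, $\Sigma_k^+=\{1,\dots,k\}^{\mathbb N}$ with left shift $\sigma(\xi)_n=\xi_{n+1}$, and cylinders $[a_0\dots a_\ell]=\{\omega\in\Sigma_k^+:\omega_0=a_0,\dots,\omega_\ell=a_\ell\}$. The set of weakly hyperbolic sequences is $S_{\mathrm t}=\{\xi\in\Sigma_k^+ : \lim_{n\to\infty}\mathrm{diam}(T_{\xi_0}\circ\cdots\circ T_{\xi_n}(I))=0\}$. A transition matrix is a $k\times k$ matrix $P=(p_{ij})$ with $p_{ij}\ge0$ and $\sum_j p_{ij}=1$ for every $i$. It is irreducible if for all $\ell,r$ some power $P^n$ has positive $(\ell,r)$ entry; it then has a unique stationary probability vector $\bar p=(p_1,\dots,p_k)$, $\bar pP=\bar p$. The Markov measure $\mathbb P^+$ associated to an irreducible transition matrix $P$ (and $\bar p$) is the Borel probability on $\Sigma_k^+$ with $\mathbb P^+([a_0\dots a_\ell])=p_{a_0}p_{a_0a_1}\cdots p_{a_{\ell-1}a_\ell}$. It is mixing if $\lim_{n\to\infty}\mathbb P^+(\sigma^{-n}(A)\cap B)=\mathbb P^+(A)\mathbb P^+(B)$ for all Borel $A,B$. A cylinder is admissible if it has positive $\mathbb P^+$-measure.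 For a non-trivial closed interval $J\subset[0,1]$, $\mathbb P^+$ splits the IFS in $J$ if: - $T_i(J)\subset J$ and $T_i|_J$ is injective for every $i\in\{1,\dots,k\}$; - there are admissible cylinders $[i_1\dots i_\ell]$ and $[j_1\dots j_s]$ of $\mathbb P^+$ with $i_1=j_1$ such that $T_{j_1}\circ\cdots\circ T_{j_s}(I)\cap T_{i_1}\circ\cdots\circ T_{i_\ell}(I)=\emptyset$ and $T_{j_1}\circ\cdots\circ T_{j_s}(I)\cup T_{i_1}\circ\cdots\circ T_{i_\ell}(I)\subset J$. *)

(* Defs.v *)
From HB Require Import structures.
From mathcomp Require Import all_boot all_order all_algebra.
From mathcomp Require Import all_classical all_reals all_analysis.

Set Implicit Arguments.
Unset Strict Implicit.
Unset Printing Implicit Defensive.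

Import Order.TTheory GRing.Theory Num.Theory.
Import numFieldNormedType.Exports.

Local Open Scope classical_set_scope.
Local Open Scope ring_scope.

HB.instance Definition _ (k : nat) := isPointed.Build 'I_k.+1 ord0.

(* The one-sided shift on k.+1 symbols.  The symbols are 'I_k.+1 = {0, ..., k}
   rather than 'I_k because measurable types must be pointed.  The measurable
   sets are the Borel sets of the product of the discrete topologies. *)
Definition shift_space (k : nat) : Type :=
  g_sigma_algebraType (@open {ptws nat -> discrete_topology 'I_k.+1}).

HB.instance Definition _ k := Measurable.on (shift_space k).

Definition shift_map k (w : shift_space k) : shift_space k := fun n => w n.+1.

Definition cylinder k (a : seq 'I_k.+1) : set (shift_space k) :=
  [set w | mkseq w (size a) = a].

Section iterated_function_system.
Context {R : realType} {k : nat}.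
Implicit Types (T : 'I_k.+1 -> R -> R) (A J : set R).

(* For a word a = [:: a_0; ...; a_l],
   word_map T a = T a_0 \o ... \o T a_l (T a_l is applied first). *)
Definition word_map T (a : seq 'I_k.+1) : R -> R := fun x => foldr T x a.

Definition diam A : R := sup [set `|x - y| | x in A & y in A].

Definition weakly_hyperbolic T : set (shift_space k) :=
  [set w | diam (word_map T (mkseq w n.+1) @` `[0, 1]) @[n --> \oo] --> (0 : R)].

Definition transition_matrix (M : 'M[R]_k.+1) : Prop :=
  (forall i j, 0 <= M i j) /\ (forall i, \sum_j M i j = 1).

Definition irreducible_matrix (M : 'M[R]_k.+1) : Prop :=
  forall i j, exists2 n, (0 < n)%N & 0 < (M ^+ n) i j.

Definition stationary_vector (M : 'M[R]_k.+1) (p : 'rV[R]_k.+1) : Prop :=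
  [/\ forall i, 0 <= p ord0 i, \sum_i p ord0 i = 1 & p *m M = p].

Implicit Types P : probability (shift_space k) R.

(* pairmap lists the transition probabilities M a_0 a_1, M a_1 a_2, ...
   along the word i :: a, where a_0 = i. *)
Definition markov_measure P : Prop :=
  exists (M : 'M[R]_k.+1) (p : 'rV[R]_k.+1),
    [/\ transition_matrix M, irreducible_matrix M, stationary_vector M p &
        forall i (a : seq 'I_k.+1),
          P (cylinder (i :: a)) =
            (p ord0 i * \prod_(q <- pairmap (fun s t => M s t) i a) q)%:E].

Definition mixing P : Prop :=
  forall A B : set (shift_space k), measurable A -> measurable B ->
    P ((iter n (@shift_map k) @^-1` A) `&` B) @[n --> \oo] --> (P A * P B)%E.

Definition admissible P (a : seq 'I_k.+1) : Prop := (0 < P (cylinder a))%E.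

(* The two words i :: a and i :: b share their first symbol. *)
Definition splits P T J : Prop :=
  (forall i, T i @` J `<=` J /\ set_inj J (T i)) /\
  exists (i : 'I_k.+1) (a b : seq 'I_k.+1),
    [/\ admissible P (i :: a), admissible P (i :: b),
        (word_map T (i :: b) @` `[0, 1]) `&` (word_map T (i :: a) @` `[0, 1])
          = set0 &
        (word_map T (i :: b) @` `[0, 1]) `|` (word_map T (i :: a) @` `[0, 1])
          `<=` J].

End iterated_function_system.

(* Main.v *)
Require Import Defs.
From mathcomp Require Import all_boot all_order all_algebra.
From mathcomp Require Import all_classical all_reals all_analysis.
From mathcomp Require Import lra.

Set Implicit Arguments.
Unset Strict Implicit.
Unset Printing Implicit Defensive.

Import Order.TTheory GRing.Theory Num.Theory.
Import numFieldNormedType.Exports.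

Local Open Scope classical_set_scope.
Local Open Scope ring_scope.

(** The images I_n(w) = T_(w_0) ( ... T_(w_n) (I)) are nested intervals, so their
    diameters fail to tend to 0 exactly when two distinct rationals lie in all
    of them ([diam_cvg0_or_rationals], [not_weakly_hyperbolicE]).  As there are
    countably many pairs of rationals, it suffices that for each fixed point x
    the set of sequences w with x in every I_n(w) is null.

    Fix x and a prefix u ending in the state s.  By irreducibility the chain
    leads with positive probability from s, along some word v, to the common
    first symbol i of the two splitting words i :: a and i :: b, and then
    continues along either a or b ([irreducible_path]).  The two splitting words
    have disjoint images inside J, and every map of the system is injective on J
    and sends J into J; hence any word placed in front of both keeps the images
    disjoint ([word_image_disjoint]).  So x lies outside the image of one of the
    prolongations u v a, u v b, and the chain started along u picks that one
    with conditional probability at least d.  There are finitely many states s,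
    so d > 0 and a bound L on the lengths of the prolongations can be chosen
    uniformly: L more steps multiply the probability that x is still in the
    image by at most 1 - d ([caught_cylinder_decay] on a prefix,
    [le_measure_prefix] to sum over prefixes).  That probability therefore tends
    to 0 geometrically ([caught_decay], [caught_null]). *)

(** * Cylinders and measures on the shift space *)

Lemma mkseq_addn (A : Type) (w : nat -> A) n m :
  mkseq w (n + m) = mkseq w n ++ mkseq (fun j => w (n + j)%N) m.
Proof.
by rewrite /mkseq iotaD map_cat add0n -{2}(addn0 n) iotaDl -map_comp.
Qed.

Lemma measurable_coord k (n : nat) (s : 'I_k.+1) :
  measurable [set w : shift_space k | w n = s].
Proof.
apply: sub_sigma_algebra.
pose f := (@proj nat (fun=> discrete_topology 'I_k.+1) n).
change (open (f @^-1` [set s] : set {ptws nat -> discrete_topology 'I_k.+1})).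
apply: open_comp; last exact: discrete_open.
by move=> w _; exact: proj_continuous.
Qed.

Lemma cylinder_rcons k (a : seq 'I_k.+1) s :
  cylinder (rcons a s) = cylinder a `&` [set w | w (size a) = s].
Proof.
apply/seteqP; split=> w; rewrite /cylinder /= size_rcons mkseqS.
  by move/rcons_inj => [-> ->].
by case=> -> ->.
Qed.

Lemma measurable_cylinder k (a : seq 'I_k.+1) : measurable (cylinder a).
Proof.
elim/last_ind: a => [|a s IH].
  rewrite (_ : cylinder _ = setT); first exact: measurableT.
  by apply/seteqP; split.
by rewrite cylinder_rcons; apply: measurableI => //; exact: measurable_coord.
Qed.

Lemma prefix_partition k n (A : set (shift_space k)) :
  A = \bigcup_(u in [set: n.-tuple 'I_k.+1]) (A `&` cylinder u).
Proof.
apply/seteqP; split=> w; last by case=> u _ [].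
move=> Aw; exists [tuple of mkseq (w : nat -> 'I_k.+1) n] => //; split=> //.
by rewrite /cylinder /= size_mkseq.
Qed.

(** [Q] is arbitrary: there are finitely many words of length [n], so any event
    that depends on the first [n] letters is a finite union of cylinders. *)
Lemma measurable_prefix k n (Q : seq 'I_k.+1 -> Prop) :
  measurable [set w : shift_space k | Q (mkseq w n)].
Proof.
rewrite (prefix_partition n [set w | _]).
apply: fin_bigcup_measurable => [|u _]; first exact: finite_finset.
have [Qu|nQu] := pselect (Q u).
  rewrite (_ : _ `&` _ = cylinder u); first exact: measurable_cylinder.
  apply/seteqP; split=> w /=; first by case.
  by move=> wu; split=> //; move: wu; rewrite /cylinder /= size_tuple => ->.
rewrite (_ : _ `&` _ = set0) //; apply/seteqP; split=> w //= -[].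
by rewrite /cylinder /= size_tuple => + wu; rewrite wu.
Qed.

(** An estimate conditional on the first n letters, uniform in those letters,
    integrates to an unconditional one. *)
Lemma le_measure_prefix k (R : realType) (P : probability (shift_space k) R)
    n (A B : set (shift_space k)) (c : R) :
  measurable A -> measurable B -> 0 <= c ->
  (forall u, size u = n ->
    (P (A `&` cylinder u) <= c%:E * P (B `&` cylinder u))%E) ->
  (P A <= c%:E * P B)%E.
Proof.
move=> mA mB c0 AB.
have E C : measurable C ->
    P C = (\sum_(u \in [set: n.-tuple 'I_k.+1]) P (C `&` cylinder u))%E.
  move=> mC; rewrite {1}(prefix_partition n C) measure_fin_bigcup //.
  - exact: finite_finset.
  - move=> u v _ _ [w [[_ wu] [_ wv]]]; apply/val_inj.
    by move: wu wv; rewrite /cylinder /= !size_tuple => -> ->.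
  - by move=> u _; apply: measurableI => //; exact: measurable_cylinder.
rewrite (E _ mA) (E _ mB) ge0_mule_fsumr => [|u]; last exact: measure_ge0.
apply: lee_fsum => [|u _]; first exact: finite_finset.
by apply: AB; rewrite size_tuple.
Qed.

Lemma measure_countable_bigcup0 d (T : measurableType d) (R : realType)
    (mu : {measure set T -> \bar R}) (I : countType) (F : I -> set T) :
  (forall i, measurable (F i)) -> (forall i, mu (F i) = 0%E) ->
  measurable (\bigcup_i F i) /\ mu (\bigcup_i F i) = 0%E.
Proof.
move=> mF F0.
have mU : measurable (\bigcup_i F i) by exact: countable_bigcupT_measurable.
split=> //; apply: measure_negligible => //.
rewrite (_ : \bigcup_i F i = \bigcup_n (oapp F set0 (unpickle n))).
  apply: negligible_bigcup => n; case: unpickle => [i|] /=.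
    by apply/negligibleP => //; exact: F0.
  exact: negligible_set0.
apply/seteqP; split=> x.
  by case=> i _ Fx; exists (pickle i) => //; rewrite pickleK.
by case=> n _; case: unpickle => //= i Fx; exists i.
Qed.

(** * Nested intervals *)

(** The endpoints of the sets converge monotonically to limits al <= be, and the
    diameters to be - al.  If al < be then any two rationals strictly between
    them lie in all the sets; two common points bound the diameters below.
    Restricting to rationals makes the exceptional set of a random nested
    sequence a countable union. *)
Lemma diam_cvg0_or_rationals (R : realType) (F : nat -> set R) :
  (forall n, F n !=set0) -> (forall n, F n `<=` `[0, 1]) ->
  (forall n, is_interval (F n)) ->
  (forall n m, (n <= m)%N -> F m `<=` F n) ->
  ~ (diam (F n) @[n --> \oo] --> (0 : R)) <->
  exists p q : rat, p < q /\ forall n, F n (ratr p) /\ F n (ratr q).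
Proof.
move=> F0 F01 Fi Fd.
have lbF n : has_lbound (F n).
  by exists 0 => x /F01; rewrite /= in_itv /= => /andP[].
have ubF n : has_ubound (F n).
  by exists 1 => x /F01; rewrite /= in_itv /= => /andP[].
have leF n x y : F n x -> F n y -> `|x - y| <= sup (F n) - inf (F n).
  move=> Fx Fy.
  have := ub_le_sup (ubF n) Fx; have := ub_le_sup (ubF n) Fy.
  have := ge_inf (lbF n) Fx; have := ge_inf (lbF n) Fy.
  by rewrite ler_norml => *; apply/andP; split; lra.
have diamF n x y : F n x -> F n y -> `|x - y| <= diam (F n).
  move=> Fx Fy; apply: ub_le_sup; last by exists x => //; exists y.
  by exists (sup (F n) - inf (F n)) => z [u Fu [v Fv <-]]; exact: leF.
split; last first.
  move=> [p [q [pq Fpq]]] d0.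
  have : 0 < (ratr q - ratr p : R) by rewrite subr_gt0 ltr_rat.
  apply/negP; rewrite -leNgt.
  apply: (ler_cvg_to (cvg_cst _) d0); apply: nearW => n /=.
  by apply: le_trans (ler_norm _) _; apply: diamF; have [] := Fpq n.
move=> nd0.
pose a n := inf (F n); pose b n := sup (F n).
have a_nd : {homo a : n m / (n <= m)%N >-> n <= m}.
  by move=> n m nm; apply: lb_le_inf => // x /(Fd _ _ nm); exact: ge_inf.
have b_ni : {homo b : n m / (n <= m)%N >-> m <= n}.
  by move=> n m nm; apply: ge_sup => // x /(Fd _ _ nm); exact: ub_le_sup.
have ab n : a n <= b n.
  by have [x Fx] := F0 n; apply: le_trans (ge_inf _ Fx) (ub_le_sup _ Fx).
have a_ub : has_ubound (range a).
  by exists (b 0%N) => _ [n _ <-]; apply: le_trans (ab n) (b_ni _ _ _).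
have b_lb : has_lbound (range b).
  by exists (a 0%N) => _ [n _ <-]; apply: le_trans (a_nd _ _ _) (ab n).
have := nondecreasing_cvgn a_nd a_ub; have := nonincreasing_cvgn b_ni b_lb.
set be := inf _; set al := sup _ => cb ca.
have [ltab|leba] := ltP al be.
  have [q qab] := rat_in_itvoo ltab.
  move: qab; rewrite in_itv /= => /andP[alq qbe].
  have [p pab] := rat_in_itvoo alq.
  move: pab; rewrite in_itv /= => /andP[alp pq].
  exists p, q; split; first by rewrite -(ltr_rat R).
  (* The sets need not be closed, so endpoints are avoided: x has elements of
     F n strictly on both sides. *)
  have inF n x : al < x -> x < be -> F n x.
    move=> alx xbe.
    have /(inf_lt (F0 n)) [y Fy yx] : inf (F n) < x.
      by apply: le_lt_trans alx; apply: (ub_le_sup a_ub); exists n.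
    have /(sup_gt (F0 n)) [z Fz xz] : x < sup (F n).
      by apply: lt_le_trans xbe _; apply: (ge_inf b_lb); exists n.
    by apply: (Fi n y z) => //; rewrite !ltW.
  by move=> n; split; apply: inF => //; lra.
exfalso; apply: nd0.
apply: (squeeze_cvgr (f := fun=> 0) (h := fun n => b n - a n)).
- apply: nearW => n; have [x Fx] := F0 n; apply/andP; split.
    by have := diamF n x x Fx Fx; apply: le_trans.
  apply: ge_sup; first by exists `|x - x|, x => //; exists x.
  by move=> z [u Fu [v Fv <-]]; exact: leF.
- exact: cvg_cst.
- suff -> : 0 = be - al by exact: cvgB.
  have : 0 <= be - al.
    apply: (ler_cvg_to (cvg_cst _) (cvgB cb ca)); apply: nearW => n /=.
    by rewrite subr_ge0.
  by move=> ?; apply/eqP; rewrite eq_le; apply/andP; split=> //; lra.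
Qed.

(** * Path probabilities of a Markov chain *)

Section markov_weights.
Context {R : realType} {k : nat}.
Implicit Types (M : 'M[R]_k.+1) (s i : 'I_k.+1) (u v : seq 'I_k.+1).

Definition path_weight M s v : R :=
  \prod_(q <- pairmap (fun s t => M s t) s v) q.

Lemma path_weight_cat M s u v :
  path_weight M s (u ++ v) = path_weight M s u * path_weight M (last s u) v.
Proof. by rewrite /path_weight pairmap_cat big_cat. Qed.

Lemma path_weight_cons M s t v :
  path_weight M s (t :: v) = M s t * path_weight M t v.
Proof. by rewrite /path_weight /= big_cons. Qed.

Lemma path_weight_ge0 M s v : transition_matrix M -> 0 <= path_weight M s v.
Proof.
move=> [M0 _]; elim: v s => [|t v IH] s; first by rewrite /path_weight big_nil.
by rewrite path_weight_cons mulr_ge0.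
Qed.

(** A positive entry of a power of the matrix is a sum over paths, so one of the
    paths has positive weight. *)
Lemma irreducible_path M s i : transition_matrix M -> irreducible_matrix M ->
  exists v, last s v = i /\ 0 < path_weight M s v.
Proof.
move=> [M0 _] /(_ s i)[n _]; elim: n s => [|n IH] s.
  rewrite expr0 mxE; case: eqP => [<- _|]; last by rewrite ltxx.
  by exists [::]; rewrite /path_weight big_nil.
rewrite exprS mxE => Mn.
have /existsP[t] : [exists t, 0 < M s t * (M ^+ n) t i].
  apply: contraLR Mn; rewrite negb_exists => /forallP Mn.
  by rewrite -leNgt; apply: sumr_le0 => t _; rewrite leNgt.
have [->|Mst] := eqVneq (M s t) 0; first by rewrite mul0r ltxx.
have {}Mst : 0 < M s t by rewrite lt_neqAle eq_sym Mst M0.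
rewrite pmulr_rgt0 // => /IH[v [vi v0]].
by exists (t :: v); rewrite path_weight_cons mulr_gt0.
Qed.

End markov_weights.

(** * Images of words *)

Section word_images.
Context {R : realType} {k : nat} (T : 'I_k.+1 -> R -> R).
Hypothesis T_maps : forall i, T i @` `[0, 1] `<=` `[0, 1].
Hypothesis T_cont : forall i, {within `[0, 1], continuous (T i)}.
Implicit Types (u v : seq 'I_k.+1) (x : R).

Definition word_image u : set R := word_map T u @` `[0, 1].

Lemma word_image_cons i u : word_image (i :: u) = T i @` word_image u.
Proof. by rewrite /word_image image_comp. Qed.

Lemma word_image_cat u v : word_image (u ++ v) = word_map T u @` word_image v.
Proof.
rewrite /word_image image_comp; congr image; apply/funext => x.
by rewrite /word_map foldr_cat.
Qed.

Lemma word_image01 u : word_image u `<=` `[0, 1].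
Proof.
elim: u => [|i u IH]; first by move=> _ [x x01 <-].
rewrite word_image_cons => _ [x /IH x01 <-].
by apply: (@T_maps i); exists x.
Qed.

Lemma word_image_sub u v : word_image (u ++ v) `<=` word_image u.
Proof. by rewrite word_image_cat; apply: image_subset; exact: word_image01. Qed.

Lemma word_image_nonempty u : word_image u !=set0.
Proof. by exists (word_map T u 0), 0 => //=; rewrite in_itv /= lexx ler01. Qed.

Lemma word_image_interval u : is_interval (word_image u).
Proof.
apply/connected_intervalP; elim: u => [|i u IH].
  rewrite (_ : word_image [::] = `[0, 1]%classic).
    exact: segment_connected.
  by rewrite /word_image image_id.
rewrite word_image_cons; apply: connected_continuous_connected => //.
exact: (continuous_subspaceW (@word_image01 u)).
Qed.

(** The injectivity of the maps on J, not on the whole interval, is enough because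
    J is invariant: all the points compared stay in J. *)
Lemma word_image_disjoint (J : set R) u v1 v2 :
  (forall i, T i @` J `<=` J /\ set_inj J (T i)) ->
  word_image v1 `|` word_image v2 `<=` J ->
  word_image v1 `&` word_image v2 = set0 ->
  word_image (u ++ v1) `&` word_image (u ++ v2) = set0.
Proof.
move=> TJ vJ v12.
have wJ w x : J x -> J (word_map T w x).
  by move=> Jx; elim: w => //= i w IH; apply: (TJ i).1; exists (word_map T w x).
have wI w : set_inj J (word_map T w).
  elim: w => [x y _ _ //|i w IH] x y xJ yJ /=.
  move=> /(TJ i).2 E; apply: IH => //.
  by apply: E; rewrite inE; apply: wJ; rewrite -inE.
apply/seteqP; split=> // x []; rewrite !word_image_cat => -[y y1 <-] [z z2].
move/wI; rewrite !inE => zy.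
have Ezy : z = y by apply: zy; apply: vJ; [right|left].
by move: z2; rewrite Ezy => y2; have : set0 y by rewrite -v12.
Qed.

(** * The point x is almost surely expelled from the nested images *)

(** The index [n.+1] matches the one in the definition of weak hyperbolicity; it
    also makes every prefix nonempty, so that it has a last state. *)
Definition caught x n : set (shift_space k) :=
  [set w | word_image (mkseq w n.+1) x].

Lemma measurable_caught x n : measurable (caught x n).
Proof. exact: (@measurable_prefix k n.+1 (fun u => word_image u x)). Qed.

Lemma word_image_prefix (w : nat -> 'I_k.+1) n m :
  (n <= m)%N -> word_image (mkseq w m) `<=` word_image (mkseq w n).
Proof. by move=> /subnKC <-; rewrite mkseq_addn; exact: word_image_sub. Qed.

(** This also gives the measurability of the set of weakly hyperbolic sequences. *)
Lemma not_weakly_hyperbolicE :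
  ~` weakly_hyperbolic T =
  \bigcup_(pq : rat * rat) (if pq.1 < pq.2
     then (\bigcap_n caught (ratr pq.1) n) `&` (\bigcap_n caught (ratr pq.2) n)
     else set0).
Proof.
have E w := @diam_cvg0_or_rationals R (fun n => word_image (mkseq w n.+1))
  (fun n => word_image_nonempty _) (fun n => @word_image01 _)
  (fun n => @word_image_interval _)
  (fun n m nm => @word_image_prefix w n.+1 m.+1 nm).
apply/seteqP; split=> w.
  move=> /E[p [q [pq wpq]]]; exists (p, q) => //=; rewrite pq.
  by split=> n _; have [] := wpq n.
case=> -[p q] _ /=; case: ifP => // pq [wp wq]; apply/E.
by exists p, q; split=> // n; split; [exact: wp|exact: wq].
Qed.

Lemma caught_decay (P : probability (shift_space k) R) (c : R) (L : nat) x :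
  0 <= c -> c < 1 ->
  (forall n, P (caught x (n + L)) <= c%:E * P (caught x n))%E ->
  P (\bigcap_n caught x n) = 0%E.
Proof.
move=> c0 c1 step.
have mI : measurable (\bigcap_n caught x n).
  by apply: bigcapT_measurable => n; exact: measurable_caught.
have bound m : (P (caught x (m * L)) <= (c ^+ m)%:E)%E.
  elim: m => [|m IH].
    by rewrite expr0; apply: probability_le1; exact: measurable_caught.
  rewrite mulSn addnC exprS EFinM; apply: le_trans (step _) _.
  by apply: lee_wpmul2l; rewrite ?lee_fin.
have bI m : (P (\bigcap_n caught x n) <= (c ^+ m)%:E)%E.
  apply: le_trans (bound m); apply: le_measure; rewrite ?inE //.
    exact: measurable_caught.
  by move=> w; apply.
apply/eqP; rewrite eq_le measure_ge0 andbT.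
apply: (@cvge_ge _ \oo _ _ (fun m => (c ^+ m)%:E)).
  exact: nearW.
by apply: cvg_EFin; [exact: nearW|apply: cvg_expr; rewrite ger0_norm].
Qed.

Definition word_law (P : probability (shift_space k) R) (M : 'M[R]_k.+1)
    (p : 'rV[R]_k.+1) :=
  forall i a, P (cylinder (i :: a)) = (p ord0 i * path_weight M i a)%:E.

(** Given the prefix, the continuation [v], of probability at least [d], expels
    [x] within [size v] steps; since the images are nested, [x] is then still
    outside after [L] steps. *)
Lemma caught_cylinder_decay P M p n L (d : R) x i u v :
  transition_matrix M -> word_law P M p ->
  size u = n -> (size v <= L)%N -> d <= path_weight M (last i u) v ->
  ~ word_image ((i :: u) ++ v) x ->
  (P (caught x (n + L) `&` cylinder (i :: u)) <=
    (1 - d)%:E * P (caught x n `&` cylinder (i :: u)))%E.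
Proof.
move=> MT PM un vL dv xv.
have cuP w : cylinder (i :: u) w -> mkseq w n.+1 = i :: u by rewrite -un.
have mC m : measurable (caught x m `&` cylinder (i :: u)).
  by apply: measurableI; [exact: measurable_caught|exact: measurable_cylinder].
have [xu|xu] := pselect (word_image (i :: u) x); last first.
  rewrite (_ : caught x (n + L) `&` _ = set0).
    rewrite (_ : caught x n `&` _ = set0) ?measure0 ?mule0 //.
    by apply/seteqP; split=> // w; rewrite /caught /= => -[+ /cuP E]; rewrite E.
  apply/seteqP; split=> // w; rewrite /caught /= => -[+ /cuP E].
  by move/(@word_image_prefix w n.+1 _ (leq_addr L n.+1)); rewrite E.
rewrite (_ : caught x n `&` _ = cylinder (i :: u)); last first.
  apply/seteqP; split=> w; first by case.
  by move=> wu; split=> //; rewrite /caught /= (cuP _ wu).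
have vu : cylinder ((i :: u) ++ v) `<=` cylinder (i :: u).
  move=> w /(congr1 (take (size (i :: u)))).
  by rewrite take_size_cat // size_cat mkseq_addn take_size_cat ?size_mkseq.
have sub : caught x (n + L) `&` cylinder (i :: u) `<=`
    cylinder (i :: u) `\` cylinder ((i :: u) ++ v).
  move=> w [wx wu]; split=> // wv; apply: xv; rewrite -wv.
  apply: word_image_prefix wx.
  by rewrite size_cat /= addSn ltnS un leq_add2l.
apply: (@le_trans _ _ (P (cylinder (i :: u) `\` cylinder ((i :: u) ++ v)))).
  apply: le_measure sub; rewrite ?inE //.
  by apply: measurableD; exact: measurable_cylinder.
have Du : P (cylinder (i :: u) `\` cylinder ((i :: u) ++ v)) =
    (P (cylinder (i :: u)) - P (cylinder ((i :: u) ++ v)))%E.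
  rewrite measureD; [|exact: measurable_cylinder..|].
    by rewrite (setIidr vu).
  by apply: le_lt_trans (probability_le1 _ _) (ltry _); exact: measurable_cylinder.
rewrite Du cat_cons !PM path_weight_cat -EFinB -EFinM lee_fin.
have : 0 <= p ord0 i * path_weight M i u by rewrite -lee_fin -PM.
by move=> pu0; rewrite mulrBl mul1r lerB // mulrA mulrC ler_wpM2l.
Qed.

(** [v1] and [v2] depend on the last state of the prefix only; which of the two
    expels [x] may depend on the whole prefix and on [x].  This is why both must
    have positive weight from that state. *)
Lemma caught_null P M p x :
  transition_matrix M -> word_law P M p ->
  (forall s, exists v1 v2, [/\ 0 < path_weight M s v1, 0 < path_weight M s v2 &
     forall u,
       word_image (rcons u s ++ v1) `&` word_image (rcons u s ++ v2) = set0]) ->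
  P (\bigcap_n caught x n) = 0%E.
Proof.
move=> MT PM /choice[f1] /choice[f2] f12.
pose d : R := \big[Order.min/1]_s
  Order.min (path_weight M s (f1 s)) (path_weight M s (f2 s)).
pose L := (\max_s maxn (size (f1 s)) (size (f2 s)))%N.
have d0 : 0 < d.
  by apply: lt_bigmin => // s _; have [? ? _] := f12 s; rewrite lt_min; apply/andP.
have d1 : d <= 1 by exact: bigmin_le_id.
have dP s : d <= Order.min (path_weight M s (f1 s)) (path_weight M s (f2 s)).
  exact: bigmin_le_cond.
have LP s : (maxn (size (f1 s)) (size (f2 s)) <= L)%N.
  exact: (@leq_bigmax _ (fun s => maxn (size (f1 s)) (size (f2 s))) s).
apply: (@caught_decay P (1 - d) L); [lra|lra|move=> n].
apply: (@le_measure_prefix _ _ P n.+1);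
  [exact: measurable_caught|exact: measurable_caught|lra|].
case=> // i u [un].
have [_ _ /(_ (belast i u))] := f12 (last i u); rewrite -lastI => dis.
have := dP (last i u); rewrite le_min => /andP[d1' d2'].
have := LP (last i u); rewrite geq_max => /andP[L1 L2].
have [x1|x1] := pselect (word_image ((i :: u) ++ f1 (last i u)) x).
  apply: (@caught_cylinder_decay P M p _ _ _ _ _ _ (f2 (last i u))) => // x2.
  by have : set0 x by rewrite -dis.
exact: (@caught_cylinder_decay P M p _ _ _ _ _ _ (f1 (last i u))).
Qed.

End word_images.

(** * Almost sure weak hyperbolicity *)

Theorem theorem5 (R : realType) (k : nat) (k_ge2 : (2 <= k.+1)%N)
    (T : 'I_k.+1 -> R -> R)
    (T_maps : forall i, T i @` `[0, 1] `<=` `[0, 1])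
    (T_cont : forall i, {within `[0, 1], continuous (T i)})
    (P : probability (shift_space k) R)
    (P_markov : markov_measure P) (P_mixing : mixing P)
    (P_splits : exists a b : R,
        [/\ a < b, `[a, b] `<=` `[0, 1] & splits P T `[a, b]]) :
  P (weakly_hyperbolic T) = 1%E.
Proof.
have [M [p [MT Mirr [p0 _ _] PM]]] := P_markov.
have [l [r [_ _ [TJ [i [a [b [Pa Pb dab abJ]]]]]]]] := P_splits.
have weight_gt0 c : admissible P (i :: c) -> 0 < path_weight M i c.
  rewrite /admissible PM lte_fin => pc.
  have pi0 : 0 < p ord0 i.
    rewrite lt_neqAle eq_sym p0 andbT; apply: contraTneq pc => ->.
    by rewrite mul0r ltxx.
  by rewrite -(pmulr_rgt0 _ pi0).
have null x : P (\bigcap_n caught T x n) = 0%E.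
  apply: (@caught_null _ _ T T_maps P M p) => // s.
  have [v [vi v0]] := irreducible_path s i MT Mirr.
  exists (v ++ a), (v ++ b); split.
  - by rewrite path_weight_cat vi mulr_gt0 // weight_gt0.
  - by rewrite path_weight_cat vi mulr_gt0 // weight_gt0.
  move=> u; rewrite !catA cat_rcons.
  (* The word s :: v ends in i, which becomes the first letter of both i :: a
     and i :: b; what precedes it is the common prefix. *)
  rewrite (lastI s v) vi -cats1 -!catA !cat1s catA catA.
  by apply: (@word_image_disjoint _ _ T `[l, r]) => //; rewrite 1?setIC 1?setUC.
have [mN PN] : measurable (~` weakly_hyperbolic T) /\
    P (~` weakly_hyperbolic T) = 0%E.
  rewrite (not_weakly_hyperbolicE T_maps T_cont).
  have mC x : measurable (\bigcap_n caught T x n).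
    by apply: bigcapT_measurable => n; exact: measurable_caught.
  apply: measure_countable_bigcup0 => -[q1 q2] /=; case: ifP => // _.
    exact: measurableI.
  by apply: subset_measure0 (null (ratr q1)) => //; exact: measurableI.
by rewrite -[weakly_hyperbolic T]setCK probability_setC // PN sube0.
Qed.
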